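(* Suppose $X$ is a Hausdorff continuum, $f:X\to 2^X$ is an idempotent surjective upper semi-continuous function, and $D$ is a totally ordered set. Let $\varprojlim\mathbf{f}$ be the inverse limit of the system $\{X,f,D\}$, and let $\varprojlim\mathbf{f}^{-1}$ be the inverse limit of the system $\{X,f^{-1},D\}$. Then $\varprojlim\mathbf{f}$ is a Hausdorff continuum if and only if $\varprojlim\mathbf{f}^{-1}$ is a Hausdorff continuum.
   Context: A Hausdorff continuum is a non-empty, compact and connected subset of a Hausdorff space. For a non-empty compact Hausdorff space $X$, $2^X$ denotes the set of non-empty compact subsets of $X$. A function $f:X\to 2^X$ is upper semi-continuous (u.s.c.) if for all $x\in X$ and every open $V\subseteq X$ containing $f(x)$ there is an open $U\subseteq X$ containing $x$ with $f(u)\subseteq V$ for each $u\in U$ (equivalently, its graph $\{(x,y)\in X\times X\mid y\in f(x)\}$ is closed). $f$ is surjective if for every $y\in X$ there is $x\in X$ with $y\in f(x)$. $f$ is idempotent if $f\circ f=f$, where $(f\circ f)(x)=\{z\in X\mid\exists y\in X\text{ with }y\in f(x)\text{ and }z\in f(y)\}$. If $f$ is u.s.c. and surjective, $f^{-1}:X\to 2^X$ is the u.s.c. function $f^{-1}(y)=\{x\in X\mid y\in f(x)\}$; when $f$ is also idempotent, $f^{-1}$ is again idempotent and surjective, so the system $\{X,f^{-1},D\}$ is defined. A totally ordered index set is a set $D$ with a reflexive, transitive, antisymmetric and total relation $\preceq$; $\alpha\prec\beta$ means $\alpha\preceq\beta$ and $\alpha\neq\beta$. For an idempotent u.s.c.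 $g:X\to 2^X$, the system $\{X,g,D\}$ has all factor spaces $X_\alpha=X$ ($\alpha\in D$), bonding functions $g_{\alpha\beta}=g$ for $\alpha\prec\beta$ in $D$, and $g_{\alpha\alpha}$ the identity on $X$. Its inverse limit is $\varprojlim\mathbf{g}=\{\mathbf{x}\in\prod_{\alpha\in D}X\mid x_\alpha\in g_{\alpha\beta}(x_\beta)\ \forall\,\alpha\preceq\beta\in D\}$, with the subspace topology from the product topology. *)

(* Defs.v *)
From mathcomp Require Import all_boot all_order.
From mathcomp Require Import boolp classical_sets topology.

Set Implicit Arguments.
Unset Strict Implicit.
Unset Printing Implicit Defensive.

Local Open Scope classical_set_scope.

Definition hausdorff_continuum (T : topologicalType) (A : set T) : Prop :=
  [/\ hausdorff_space T, A !=set0, compact A & connected A].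

(* The points of 2^X; a function X -> 2^X is represented by a map
   f : X -> set X such that hyperspace (f x) for all x. *)
Definition hyperspace (X : topologicalType) : set (set X) :=
  [set A | A !=set0 /\ compact A].

Definition usc (X : topologicalType) (f : X -> set X) : Prop :=
  forall (x : X) (V : set X), open V -> f x `<=` V ->
    exists U : set X, [/\ open U, U x & forall u, U u -> f u `<=` V].

Definition sv_surjective (X : Type) (f : X -> set X) : Prop :=
  forall y, exists x, f x y.

Definition sv_comp (X : Type) (g f : X -> set X) : X -> set X :=
  fun x => [set z | exists y, f x y /\ g y z].

Definition sv_idempotent (X : Type) (f : X -> set X) : Prop :=
  sv_comp f f = f.

Definition sv_inv (X : Type) (f : X -> set X) : X -> set X :=
  fun y => [set x | f x y].

Definition const_bonding (X : Type) d (D : orderType d) (g : X -> set X)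
    (a b : D) : X -> set X :=
  if a == b then fun x => [set x] else g.

Definition inverse_limit (X : topologicalType) d (D : orderType d)
    (g : D -> D -> X -> set X) : set {ptws D -> X} :=
  [set x | forall a b : D, (a <= b)%O -> g a b (x b) (x a)].

(* {X, f^-1, D} is a system of the same kind as {X, f, D}. *)
Lemma sv_inv_surjective (X : topologicalType) (f : X -> set X) :
  (forall x, hyperspace (f x)) -> sv_surjective (sv_inv f).
Proof. by move=> f2X x; have [[y fxy] _] := f2X x; exists y. Qed.

Lemma sv_inv_idempotent (X : Type) (f : X -> set X) :
  sv_idempotent f -> sv_idempotent (sv_inv f).
Proof.
move=> ff; apply/funext => z; apply/seteqP; split=> x.
  by move=> [y [fyz fxy]]; rewrite /sv_inv /= -ff; apply: ex_intro (conj fxy fyz).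
by rewrite {1}/sv_inv /= -{1}ff => -[y [fxy fyz]]; exists y.
Qed.

Section sv_inv_usc.
Variables (X : topologicalType) (f : X -> set X).
Hypotheses (hX : hausdorff_space X) (cX : compact [set: X]).
Hypotheses (f2X : forall x, hyperspace (f x)) (fusc : usc f).

(* {x | f x meets C} is closed, for C closed *)
Let closed_meets (C : set X) :
  closed C -> closed [set x | f x `&` C !=set0].
Proof.
move=> cC; rewrite -openC openE => x /= nfC.
case: (@fusc x (~` C) (closed_openC cC)) => [|U [oU Ux UC]].
  by move=> y fxy Cy; apply: nfC; exists y.
rewrite /interior nbhsE; exists U => // u Uu [y [fuy Cy]].
exact: UC Uu y fuy Cy.
Qed.

Lemma sv_inv_hyperspace : sv_surjective f ->
  forall y, hyperspace (sv_inv f y).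
Proof.
move=> fsurj y; split; first exact: fsurj.
apply: (subclosed_compact _ cX) => //.
suff -> : sv_inv f y = [set x | f x `&` [set y] !=set0].
  by apply: closed_meets; apply/accessible_closed_set1/hausdorff_accessible.
by apply/seteqP; split=> x /= => [fxy|[_ [? <-]]] //; exists y.
Qed.

Lemma sv_inv_usc : usc (sv_inv f).
Proof.
move=> y V oV fyV.
have cVC : compact (~` V).
  by apply: (subclosed_compact _ cX) => //; exact: open_closedC.
suff : \forall u \near nbhs y, ~` V `<=` (fun x => ~ f x u).
  rewrite /= nbhsE => -[U [oU Uy] UW].
  exists U; split => // u Uu x fxu.
  by apply: contrapT => nVx; exact: (UW u Uu x nVx fxu).
apply: (compact_near_coveringP _).1 cVC _ _ (fun u x => ~ f x u) _ _ => x nVx.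
have nfxy : ~ f x y by move=> fxy; exact/nVx/fyV.
have clx : closed (f x) by apply: compact_closed hX (f2X x).2.
have [B [nyB clB BC]] : exists B : set X,
    [/\ nbhs y B, closed B & B `<=` ~` f x].
  have := compact_regular hX cX filterT.
  move=> /(_ y _ (~` f x)) [|B By clB]; last first.
    exists (closure B); split => //; last exact: closed_closure.
    exact: filterS (@subset_closure _ B) By.
  by apply: open_nbhs_nbhs; split => //; exact: closed_openC.
have cM := closed_meets clB.
exists (~` [set x0 | f x0 `&` B !=set0], B) => /=.
  split => //; apply: open_nbhs_nbhs; split; first exact: closed_openC.
  by move=> [z [fxz Bz]]; exact: BC Bz fxz.
by move=> [a u] /= [na Bu] fau; apply: na; exists u.
Qed.

End sv_inv_usc.

(* Main.v *)
(* Over a finite index set the inverse limit of f^-1 is that of f with the order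
   of the coordinates reversed.  Since f is idempotent, total and surjective, a
   partial thread on a finite set of indices can be refined at any further
   index, so by compactness it extends to a full thread.  If the limit L' of
   f^-1 were the disjoint union of nonempty compact sets A and B, then by
   compactness A and B would already differ on some finite s; reversing the
   coordinates in s turns the connected limit of f into a connected set with
   the same traces on s as L', and A and B would disconnect it. *)
Require Import Defs.
From mathcomp Require Import all_boot all_order.
From mathcomp Require Import boolp classical_sets topology.

Set Implicit Arguments.
Unset Strict Implicit.
Unset Printing Implicit Defensive.

Import Order.TTheory.
Local Open Scope classical_set_scope.

(** An arbitrary total transitive relation is allowed so that [<=] and [>=] both apply, giving the
    largest and the smallest index of a list. *)
Lemma exists_max_seq (T : eqType) (r : rel T) (s : seq T) :
  total r -> transitive r -> s != [::] ->
  exists2 m, m \in s & {in s, forall a, r a m}.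
Proof.
move=> rtot rtr; elim: s => [//|a [_ _|b s IH _]].
  exists a; first exact: mem_head.
  by move=> c; rewrite inE => /eqP ->; case/orP: (rtot a a).
have [//|m ms mmax] := IH; case/orP: (rtot a m) => ram.
  exists m; first by rewrite inE ms orbT.
  by move=> c; rewrite inE => /predU1P[->//|/mmax].
exists a; first exact: mem_head.
move=> c; rewrite inE => /predU1P[->|/mmax rcm]; first by case/orP: (rtot a a).
exact: rtr ram.
Qed.

(** Regularity gives a point off [f x] a neighbourhood [B] whose closure misses [f x];
    semi-continuity then keeps [f u] off that closure for [u] near [x]. *)
Lemma usc_closed_graph (X : topologicalType) (f : X -> set X) :
  hausdorff_space X -> compact [set: X] ->
  (forall x, hyperspace (f x)) -> usc f ->
  closed [set p : X * X | f p.1 p.2].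
Proof.
move=> hX cX f2X fusc; rewrite -openC openE => -[x z] /= nfxz.
have clx : closed (f x) by apply: compact_closed hX (f2X x).2.
have fxz : nbhs z (~` f x).
  by apply: open_nbhs_nbhs; split => //; exact: closed_openC.
have [B zB BC] := compact_regular hX cX filterT fxz.
have [||U [oU Ux UB]] := fusc x (~` closure B).
- exact/closed_openC/closed_closure.
- by move=> y fxy /BC.
exists (U, B) => /=; first by split => //; exact: open_nbhs_nbhs.
by move=> [u v] /= [Uu Bv] fuv; apply: (UB u Uu v fuv); exact: subset_closure.
Qed.

Lemma closed_graph_sv_inv (X : topologicalType) (f : X -> set X) :
  closed [set p : X * X | f p.1 p.2] ->
  closed [set p : X * X | sv_inv f p.1 p.2].
Proof.
move=> cf; apply: (@preimage_closed (X * X)%type (X * X)%type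
  (fun p => (p.2, p.1)) [set p | f p.1 p.2]) => // p _.
exact: (cvg_pair (@cvg_snd _ _ _ _ _) (@cvg_fst _ _ _ _ _)).
Qed.

(** * Partial threads on finite sets of indices *)

Section chains.
Variables (X : topologicalType) (d : Order.disp_t) (D : orderType d).
Implicit Types (g : X -> set X) (s t : seq D) (x y : {ptws D -> X}).

(** A partial thread is a point of the whole product, with arbitrary values off [s], so that all
    partial threads live in one compact space. *)
Definition chain_on g s : set {ptws D -> X} :=
  [set x | {in s &, forall a b : D, (a < b)%O -> g (x b) (x a)}].

Lemma inverse_limit_chain g x :
  inverse_limit (@const_bonding X d D g) x <-> forall s, chain_on g s x.
Proof.
split=> [xl s a b _ _ ab|xc a b].
  by have := xl a b (ltW ab); rewrite /const_bonding lt_eqF.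
rewrite le_eqVlt /const_bonding; case: eqVneq => [->//|_ /= ab].
by apply: (xc [:: a; b]) ab; rewrite !inE eqxx ?orbT.
Qed.

Lemma eval_continuous (a : D) : continuous (fun x : {ptws D -> X} => x a).
Proof. exact: (@proj_continuous D (fun=> X) a). Qed.

Lemma closed_chain_on g s :
  closed [set p : X * X | g p.1 p.2] -> closed (chain_on g s).
Proof.
move=> cg.
have -> : chain_on g s = \bigcap_(p in [set p : D * D |
    [&& p.1 \in s, p.2 \in s & (p.1 < p.2)%O]])
    [set x : {ptws D -> X} | g (x p.2) (x p.1)].
  apply/seteqP; split=> [x xs [a b] /= /and3P[]|x xs a b as_ bs ab].
    exact: xs.
  by apply: (xs (a, b)); apply/and3P.
apply: closed_bigI => -[a b] _ /=.
apply: (@preimage_closed {ptws D -> X} (X * X)%type (fun x => (x b, x a))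
  [set p | g p.1 p.2]) => // x _.
exact: (cvg_pair (@eval_continuous b x) (@eval_continuous a x)).
Qed.

Lemma closed_inverse_limit g : closed [set p : X * X | g p.1 p.2] ->
  closed (inverse_limit (@const_bonding X d D g)).
Proof.
move=> cg.
have -> : inverse_limit (@const_bonding X d D g) = \bigcap_s chain_on g s.
  apply/seteqP; split=> x.
    by move=> /inverse_limit_chain xs s _; exact: xs.
  by move=> xs; apply/inverse_limit_chain => s; exact: xs.
by apply: closed_bigI => s _; exact: closed_chain_on.
Qed.

Lemma compact_ptws : compact [set: X] -> compact [set: {ptws D -> X}].
Proof.
move=> cX; have := @tychonoff D (fun=> X) (fun=> setT) (fun=> cX).
by congr (@compact {ptws D -> X} _); apply/seteqP; split.
Qed.

(** * Extending partial threads to full threads *)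

Section extension.
Variable g : X -> set X.
Hypotheses (g_total : forall u, exists v, g u v).
Hypotheses (g_surj : sv_surjective g) (g_idem : sv_idempotent g).

(** The two inclusions of idempotence: one makes [g] transitive as a relation, the other lets a
    value be inserted between two related ones. *)
Let g_trans u v w : g u v -> g v w -> g u w.
Proof. by move=> uv vw; rewrite -g_idem; exists v. Qed.

Let g_split u w : g u w -> exists2 v, g u v & g v w.
Proof. by rewrite -{1}g_idem => -[v [? ?]]; exists v. Qed.

Lemma chain_on_cons c s x : chain_on g s x ->
  exists2 y, chain_on g (c :: s) y & {in s, y =1 x}.
Proof.
move=> xs; have [cs|cs] := boolP (c \in s).
  by exists x => // a b; rewrite !inE => /predU1P[->|+] /predU1P[->|+]; auto.
suff [z zlo zhi] : exists2 z, {in s, forall a, (a < c)%O -> g z (x a)} &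
    {in s, forall b, (c < b)%O -> g (x b) z}.
  exists (fun a => if a == c then z else x a) => [a b|a as_]; last first.
    by case: eqVneq => // ac; rewrite -ac as_ in cs.
  rewrite !inE; case: (eqVneq a c) => [->|_]; case: (eqVneq b c) => [->|_] //=.
  - by rewrite ltxx.
  - by move=> _ ? ?; exact: zhi.
  - by move=> ? _ ?; exact: zlo.
  - exact: xs.
set lo := [seq a <- s | (a < c)%O]; set hi := [seq b <- s | (c < b)%O].
have loE a : a \in s -> (a < c)%O -> a \in lo by rewrite mem_filter => -> ->.
have hiE a : a \in s -> (c < a)%O -> a \in hi by rewrite mem_filter => -> ->.
(* By transitivity only the nearest indices [p] below and [q] above [c] constrain the new value. *)
have lo_max : lo != [::] -> exists p, [/\ p \in s, (p < c)%O &
    forall z, g z (x p) -> {in s, forall a, (a < c)%O -> g z (x a)}].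
  move=> /(exists_max_seq le_total le_trans)[p].
  rewrite mem_filter => /andP[pc ps] pmax; exists p; split=> // z zp a as_ ac.
  have := pmax _ (loE _ as_ ac); rewrite le_eqVlt => /predU1P[->//|ap].
  exact: g_trans zp (xs _ _ as_ ps ap).
have hi_min : hi != [::] -> exists q, [/\ q \in s, (c < q)%O &
    forall z, g (x q) z -> {in s, forall b, (c < b)%O -> g (x b) z}].
  move=> /(exists_max_seq ge_total ge_trans)[q].
  rewrite mem_filter => /andP[cq qs] qmin; exists q; split=> // z qz b bs cb.
  have := qmin _ (hiE _ bs cb); rewrite /= le_eqVlt => /predU1P[<-//|qb].
  exact: g_trans (xs _ _ qs bs qb) qz.
(* With no neighbour, [s] is empty and any value serves; with only [q], totality supplies one; with
   only [p], surjectivity; with both, splitting [g (x q) (x p)]. *)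
have [lo0|/lo_max[p [ps pc pz]]] := eqVneq lo [::];
  have [hi0|/hi_min[q [qs cq qz]]] := eqVneq hi [::].
- exists (x c) => a as_ ac; first by have := loE _ as_ ac; rewrite lo0.
  by have := hiE _ as_ ac; rewrite hi0.
- have [z xqz] := g_total (x q); exists z; last exact: qz.
  by move=> a as_ ac; have := loE _ as_ ac; rewrite lo0.
- have [z zxp] := g_surj (x p); exists z; first exact: pz.
  by move=> a as_ ac; have := hiE _ as_ ac; rewrite hi0.
- have [z qz' zp] := g_split (xs _ _ ps qs (lt_trans pc cq)).
  by exists z; [exact: pz|exact: qz].
Qed.

Lemma chain_on_cat t s x : chain_on g s x ->
  exists2 y, chain_on g (t ++ s) y & {in s, y =1 x}.
Proof.
move=> xs; elim: t => [|c t [y yts yx]]; first by exists x.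
have [z zc zy] := chain_on_cons c yts; exists z => // a as_.
by rewrite zy ?yx // mem_cat as_ orbT.
Qed.

Lemma chain_on_extend s x : hausdorff_space X -> compact [set: X] ->
  closed [set p : X * X | g p.1 p.2] -> chain_on g s x ->
  exists2 y, inverse_limit (@const_bonding X d D g) y & {in s, y =1 x}.
Proof.
move=> hX cX cg xs.
(* A cluster point of this filter lies in each of its closed members, hence is a chain on every
   finite [t] and still agrees with [x] on [s]. *)
pose F := filter_from [set: seq D]
  (fun t => [set y : {ptws D -> X} | chain_on g t y /\ {in s, y =1 x}]).
have FF : ProperFilter F.
  apply: filter_from_proper; last first.
    move=> t _; have [y yts yx] := chain_on_cat t xs.
    by exists y; split=> // a b at_ bt; apply: yts; rewrite mem_cat ?at_ ?bt.
  apply: filter_from_filter; first by exists [::].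
  move=> t u _ _; exists (t ++ u) => // y [ytu yx].
  by split; split=> // a b ha hb; apply: ytu; rewrite mem_cat ?ha ?hb ?orbT.
have [y [_ Fy]] := compact_ptws cX FF filterT.
have clF (A : set {ptws D -> X}) : closed A -> F A -> A y.
  by move=> cA FA; apply: cA => B yB; exact: Fy.
exists y.
  apply/inverse_limit_chain => t; apply: (clF _ (@closed_chain_on g t cg)).
  by exists t => // z [].
move=> a as_; apply: (clF [set z : {ptws D -> X} | z a = x a]); last first.
  by exists [::] => // z [_]; exact.
apply: (@preimage_closed _ _ (fun z : {ptws D -> X} => z a) [set x a]);
  last exact/accessible_closed_set1/hausdorff_accessible.
by move=> z _; exact: eval_continuous.
Qed.

End extension.

(** * Reindexing, and comparison of points on finitely many coordinates *)

Lemma reindex_continuous (rho : D -> D) :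
  continuous (fun x : {ptws D -> X} => (x \o rho : {ptws D -> X})).
Proof.
move=> x; apply/cvg_sup.
  exact/fmap_filter/(nbhs_filter (x : {ptws D -> X})).
move=> a A /=.
rewrite (@nbhsE (initial_topology _)) => -[B [[C oC <-] Cx] CA].
have : nbhs x ((fun y : {ptws D -> X} => y (rho a)) @^-1` C).
  by apply: eval_continuous; apply: open_nbhs_nbhs.
by apply: filterS => y Cy; exact: CA.
Qed.

Lemma near_neq_eval x y (a : D) : hausdorff_space X -> x a <> y a ->
  \forall x' \near x & y' \near y, x' a <> y' a.
Proof.
rewrite open_hausdorff => hX /eqP /hX[[U V] /= [/set_mem Ux /set_mem Vy]].
move=> [oU oV /eqP UV0].
exists ((fun z : {ptws D -> X} => z a) @^-1` U,
        (fun z : {ptws D -> X} => z a) @^-1` V).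
  by split; apply: eval_continuous; exact: open_nbhs_nbhs.
move=> [x' y'] /= [Ux' Vy'] xy; suff : (U `&` V) (x' a) by rewrite UV0.
by split; rewrite // xy.
Qed.

(** The preimage of the projection of [A] to the coordinates in [s], written without forming the
    finite product. *)
Definition agree_on s (A : set {ptws D -> X}) : set {ptws D -> X} :=
  [set x | exists2 a, A a & {in s, a =1 x}].

Lemma closed_agree_on s (A : set {ptws D -> X}) :
  hausdorff_space X -> compact A -> closed (agree_on s A).
Proof.
move=> hX cA; rewrite -openC openE => x /= nAx.
suff : \forall y \near x, A `<=` (fun a => ~ {in s, a =1 y}).
  by apply: filterS => y Ay [a Aa ay]; exact: Ay Aa ay.
apply: ((compact_near_coveringP A).1 cA _ (nbhs x)
  (fun y a => ~ {in s, a =1 y}) (nbhs_filter x)) => a Aa.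
have [i [is_ ai]] : exists i, i \in s /\ a i <> x i.
  apply: contrapT => /forallNP h; apply: nAx; exists a => // i is_.
  by apply: contrapT => ai; exact: (h i).
have [[U V] [aU xV] UV] := near_neq_eval hX ai.
by exists (U, V) => // -[a' y] a'y /(_ i is_); exact: UV.
Qed.

Lemma disjoint_on_seq (A B : set {ptws D -> X}) :
  hausdorff_space X -> compact A -> compact B -> A `&` B = set0 ->
  exists s0, forall s, {subset s0 <= s} ->
    forall a b, A a -> B b -> ~ {in s, a =1 b}.
Proof.
move=> hX cA cB AB.
(* Along this filter a list eventually contains any given finite set of indices. Compactness is used
   twice, over [A] and then over [B], to make one finite set separate all pairs. *)
pose F := filter_from [set: seq D]
  (fun s0 => [set s : seq D | {subset s0 <= s}]).
have FF : Filter F.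
  apply: filter_from_filter; first by exists [::].
  move=> t u _ _; exists (t ++ u) => // s tus.
  by split=> i it; apply: tus; rewrite mem_cat it ?orbT.
suff : \forall s \near F, A `<=` (fun a => B `<=` (fun b => ~ {in s, a =1 b})).
  by move=> [s0 _ s0P]; exists s0 => s s0s a b Aa; exact: s0P.
apply: ((compact_near_coveringP A).1 cA _ F
  (fun s a => B `<=` (fun b => ~ {in s, a =1 b})) FF) => a Aa.
pose P (p : {ptws D -> X} * seq D) b := ~ {in p.2, p.1 =1 b}.
suff : \forall p \near filter_prod (nbhs a) F, B `<=` P p by [].
apply: ((compact_near_coveringP B).1 cB _ _ P) => b Bb.
have [i ai] : exists i, a i <> b i.
  apply: contrapT => /forallNP ab; have : (A `&` B) a; last by rewrite AB.
  split=> //; suff -> : a = b by [].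
  by apply/funext => i; apply: contrapT; exact: ab.
have [[U V] [aU bV] UV] := near_neq_eval hX ai.
exists (V, U `*` [set s : seq D | i \in s])
    => [|[b' [a' s]] /= [Vb' [Ua' is_]]].
  split=> //; exists (U, [set s : seq D | i \in s]) => //; split=> //.
  by exists [:: i] => // s /(_ i); apply; rewrite mem_head.
by move=> /(_ i is_); exact: (UV (a', b')).
Qed.

Lemma reverse_seq s : exists2 t : seq D, {subset s <= t} & exists rho : D -> D,
  [/\ {in t, forall a, rho a \in t}, {in t, cancel rho rho} &
      {in t &, forall a b, (a < b)%O -> (rho b < rho a)%O}].
Proof.
set t := sort <=%O (undup s).
have st : sorted <%O t by rewrite sort_lt_sorted undup_uniq.
have ut : uniq t by rewrite sort_uniq undup_uniq.
exists t; first by move=> a; rewrite mem_sort mem_undup.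
(* Positions count from 0, so position [i] is mirrored to [size t - i.+1]. For [a] in [t] this is in
   range and the default is never reached. *)
exists (fun a => nth a t (size t - (index a t).+1)).
have idx a : a \in t -> size t - (index a t).+1 < size t.
  by rewrite -index_mem; case: (size t) => // n _; rewrite subSS ltnS leq_subr.
split=> [a at_|a at_|a b at_ bt ab].
- exact/mem_nth/idx.
- rewrite index_uniq ?idx // subnSK ?index_mem // subKn; last first.
    by rewrite ltnW ?index_mem.
  by rewrite (set_nth_default a) ?index_mem ?nth_index.
- rewrite (set_nth_default a b) ?idx // lt_sorted_ltn_nth ?inE ?idx //.
  have iab : index a t < index b t.
    by rewrite -(lt_sorted_ltn_nth a st) ?inE ?index_mem // !nth_index.
  by rewrite ltn_sub2l ?ltnS // (leq_ltn_trans iab) ?index_mem.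
Qed.

End chains.

(** The hypotheses on [f] are symmetric under [sv_inv], which exchanges totality and surjectivity,
    so one implication serves for both directions. *)
Lemma inverse_limit_sv_inv_continuum (X : topologicalType) (f : X -> set X)
    (d : Order.disp_t) (D : orderType d) :
  hausdorff_space X -> compact [set: X] ->
  closed [set p : X * X | f p.1 p.2] ->
  (forall x, exists y, f x y) -> sv_surjective f -> sv_idempotent f ->
  hausdorff_continuum (inverse_limit (@const_bonding X d D f)) ->
  hausdorff_continuum (inverse_limit (@const_bonding X d D (sv_inv f))).
Proof.
move=> hX cX cf ftot fsurj fidem [hD [x0 _] _ Lconn].
have cg : closed [set p : X * X | sv_inv f p.1 p.2].
  exact: closed_graph_sv_inv.
have gext := @chain_on_extend X d D (sv_inv f) fsurj ftot
  (sv_inv_idempotent fidem) _ _ hX cX cg.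
have fext := @chain_on_extend X d D f ftot fsurj fidem _ _ hX cX cf.
set L := inverse_limit _ in Lconn; set L' := inverse_limit _.
have clL' : closed L' by exact: closed_inverse_limit.
have cptL' : compact L' by exact: subclosed_compact clL' (compact_ptws cX) _.
(* Every point is a chain on the empty list, so extending [x0] from there gives a thread. *)
split=> //; first by have [//|y L'y _] := gext [::] x0; exists y.
move=> B [b0 Bb0] [C1 oC1 BE1] [C2 cC2 BE2].
apply: contrapT => BL'.
pose A := L' `&` ~` C1.
have [a0 Aa0] : A !=set0.
  apply: contrapT => /nonemptyPn A0; apply: BL'; rewrite BE1.
  apply/seteqP; split=> [x []//|x L'x]; split=> //.
  by apply: contrapT => nC1; have : A x by []; rewrite A0.
have cptA : compact A.
  apply: subclosed_compact _ cptL' _; last exact: subIsetl.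
  by apply: closedI => //; exact: open_closedC.
have cptB : compact B.
  rewrite BE2; apply: subclosed_compact _ cptL' _; last exact: subIsetl.
  exact: closedI.
have AB : A `&` B = set0.
  by apply/seteqP; split=> x // [[_ nC1]]; rewrite BE1 => -[].
have ABL' x : L' x -> A x \/ B x.
  by move=> L'x; have [C1x|nC1x] := pselect (C1 x); [right; rewrite BE1|left].
have BsubL' : B `<=` L' by rewrite BE1; exact: subIsetl.
have [s0 sep] := disjoint_on_seq hX cptA cptB AB.
have [s s0s [rho [rhos rhoK rhod]]] := @reverse_seq d D s0.
pose M := (fun x : {ptws D -> X} => (x \o rho : {ptws D -> X})) @` L.
have Mconn : connected M.
  apply: connected_continuous_connected Lconn _.
  exact/continuous_subspaceT/reindex_continuous.
(* Since [rho] reverses the order on [s], reindexing turns a chain for [f] into one for [sv_inv f]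
   on [s], and conversely. *)
have ML' x : M x -> exists2 y, L' y & {in s, y =1 x}.
  move=> [y /inverse_limit_chain Ly <-]; apply: gext => a b as_ bs ab.
  by apply: (Ly s); rewrite ?rhos // rhod.
have L'M y : L' y -> exists2 x, M x & {in s, y =1 x}.
  move=> /inverse_limit_chain L'y.
  have [a b as_ bs ab|x Lx xy] := fext s (y \o rho).
    by apply: (L'y s); rewrite ?rhos // rhod.
  exists (x \o rho); first by exists x.
  by move=> a as_ /=; rewrite xy ?rhos //= rhoK.
have Mdisj x : agree_on s A x -> agree_on s B x -> False.
  move=> [a Aa ax] [b Bb bx]; apply: (sep s s0s a b Aa Bb) => i is_.
  by rewrite ax ?bx.
have ME : M `&` agree_on s B = M.
  apply: Mconn.
  - by have [x Mx bx] := L'M b0 (BsubL' _ Bb0); exists x; split=> //; exists b0.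
  (* Within [M] the traces of [A] and [B] are complementary: they cover because [A] and [B] cover
     [L'], and are disjoint by the choice of [s]. *)
  - exists (~` agree_on s A); first exact/closed_openC/closed_agree_on.
    apply/seteqP; split=> x [Mx xB]; split=> //.
      by move=> xA; exact: Mdisj xA xB.
    have [y L'y yx] := ML' x Mx; have [Ay|By] := ABL' y L'y; last by exists y.
    by exfalso; apply: xB; exists y.
  - by exists (agree_on s B) => //; exact: closed_agree_on.
have [x Mx ax] := L'M a0 Aa0.1.
by apply: (@Mdisj x); [exists a0|move: Mx; rewrite -ME => -[]].
Qed.

Theorem theorem5p9 (X : topologicalType) (f : X -> set X)
    (d : Order.disp_t) (D : orderType d)
    (continuumX : hausdorff_continuum [set: X]%classic)
    (f_hyperspace : forall x : X, hyperspace (f x))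
    (f_usc : usc f)
    (f_surjective : sv_surjective f)
    (f_idempotent : sv_idempotent f) :
  hausdorff_continuum (inverse_limit (@const_bonding X d D f)) <->
  hausdorff_continuum (inverse_limit (@const_bonding X d D (sv_inv f))).
Proof.
have [hX _ cX _] := continuumX.
have cf := usc_closed_graph hX cX f_hyperspace f_usc.
have ftot x : exists y, f x y by have [] := f_hyperspace x.
split; first exact: inverse_limit_sv_inv_continuum.
(* [sv_inv (sv_inv f)] is convertible to [f]. *)
apply: (@inverse_limit_sv_inv_continuum X (sv_inv f)) => //.
- exact: closed_graph_sv_inv.
- exact: sv_inv_idempotent.
Qed.
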